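(* Let $\gamma$ be a regular, arclength parametrized curve in a 2-dimensional space form of constant curvature $G$ and let $\kappa$ be its geodesic curvature. Then the Schwarzian derivative $q$ of $\gamma$ is $$q=\frac{i\kappa'}{2}+\frac{\kappa^2}{4}+\frac{G}{4}.$$ Further, if $\gamma$ is constrained elastic in the space form, i.e. $\kappa$ is a real solution of the stationary mKdV equation $$\kappa''+\tfrac12\kappa^3+(\mu+G)\kappa+\lambda=0,\qquad (\kappa')^2=-\tfrac14\kappa^4-(\mu+G)\kappa^2-2\lambda\kappa-\nu$$ with real parameters $\mu,\lambda,\nu$, then $q$ satisfies the stationary KdV equation $$(q')^2+2q^3+cq^2+2dq+e=0$$ with real parameters $$c=\mu-\tfrac{G}{2},\qquad d=-\tfrac{\nu}{4}-\tfrac{G^2}{16}-\tfrac{\mu G}{4},\qquad e=cd+\tfrac{\lambda^2}{4}+\tfrac{\mu^2G}{4}-\tfrac{\nu G}{4}.$$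
   Context: The 2-dimensional space forms ($\mathbb{R}^2$, round spheres, hyperbolic planes) are viewed, by orientation-preserving conformal models (affine coordinate / stereographic projection), as subsets of $\mathbb{CP}^1$. Schwarzian derivative: for a regular curve $\gamma$ in $\mathbb{CP}^1$ choose a lift $\tilde\gamma$ to $\mathbb{C}^2\setminus\{0\}$ and a complex-valued function $a$ such that $\hat\gamma=a\tilde\gamma$ satisfies $\det_{\mathbb{C}}(\hat\gamma,\hat\gamma')=1$. Then $\hat\gamma''+q\hat\gamma=0$ for a unique complex-valued function $q$, called the Schwarzian derivative of $\gamma$ (with respect to the given parameter). The constant $\nu$ is the integration constant obtained by integrating the second-order equation once after multiplying by $2\kappa'$. *)

(* Defs.v *)
From Stdlib Require Import Reals.
From Coquelicot Require Import Coquelicot.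

Open Scope R_scope.

Definition Rbar_interval (a b : Rbar) (s : R) : Prop :=
  Rbar_lt a s /\ Rbar_lt s b.

(* [ex_derive_n f k] only speaks about the last of the k derivations, whence
   the quantification over all the orders. *)
Definition differentiable_at (n : nat) (f : R -> R) (s : R) : Prop :=
  forall k : nat, (k <= n)%nat -> ex_derive_n f k s.

(** * The space forms *)

Definition R3 : Type := (R * R * R)%type.
Definition x1 (p : R3) : R := fst (fst p).
Definition x2 (p : R3) : R := snd (fst p).
Definition x3 (p : R3) : R := snd p.

(* Euclidean for G > 0 and Lorentzian for G < 0.  For G = 0 the third
   coordinate vanishes on the space form, so its coefficient is irrelevant. *)
Definition dot (G : R) (u v : R3) : R :=
  x1 u * x1 v + x2 u * x2 v + sign G * (x3 u * x3 v).

(* The sphere of radius 1/sqrt G, the upper sheet of the hyperboloid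
   x1^2 + x2^2 - x3^2 = 1/G, or the plane x3 = 0. *)
Definition space_form (G : R) (p : R3) : Prop :=
  (0 < G -> dot G p p = / G) /\
  (G < 0 -> dot G p p = / G /\ 0 < x3 p) /\
  (G = 0 -> x3 p = 0).

(* Unit normal fixing the orientation: outward for the sphere, future pointing
   (timelike) for the hyperboloid, upward for the plane. *)
Definition normal (G : R) (p : R3) : R3 :=
  if Req_dec_T G 0 then (0, 0, 1)
  else (sqrt (Rabs G) * x1 p, sqrt (Rabs G) * x2 p, sqrt (Rabs G) * x3 p).

(* Rotation by +90 degrees in the tangent plane at p, as the cross product
   n x v for [dot G]:  dot G (n x v) w = det (n, v, w).  The orientation is the
   one for which (e1, J e1) = (e1, e2) at the point with x1 = x2 = 0
   (and x3 >= 0). *)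
Definition J (G : R) (p v : R3) : R3 :=
  let n := normal G p in
  (x2 n * x3 v - x3 n * x2 v,
   x3 n * x1 v - x1 n * x3 v,
   sign G * (x1 n * x2 v - x2 n * x1 v)).

Definition velocity (g : R -> R3) (s : R) : R3 :=
  (Derive (fun t => x1 (g t)) s,
   Derive (fun t => x2 (g t)) s,
   Derive (fun t => x3 (g t)) s).

Definition acceleration (g : R -> R3) (s : R) : R3 :=
  velocity (velocity g) s.

(* Covariant derivative of the velocity along g: the tangential part of the
   acceleration.  For G <> 0 the normal direction is spanned by the position
   vector, with dot G (g s) (g s) = 1/G. *)
Definition covariant_acceleration (G : R) (g : R -> R3) (s : R) : R3 :=
  let w := acceleration g s in
  let k := G * dot G w (g s) in
  (x1 w - k * x1 (g s), x2 w - k * x2 (g s), x3 w - k * x3 (g s)).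

(* For arclength parametrized curves. *)
Definition geodesic_curvature (G : R) (g : R -> R3) (s : R) : R :=
  dot G (covariant_acceleration G g s) (J G (g s) (velocity g s)).

(* Three times differentiable, so that the derivative of the geodesic curvature
   exists. *)
Definition arclength_curve (G : R) (I : R -> Prop) (g : R -> R3) : Prop :=
  forall s : R, I s ->
    space_form G (g s) /\
    differentiable_at 3 (fun t => x1 (g t)) s /\
    differentiable_at 3 (fun t => x2 (g t)) s /\
    differentiable_at 3 (fun t => x3 (g t)) s /\
    dot G (velocity g s) (velocity g s) = 1.

(** * The complex projective line and the Schwarzian derivative *)

(* The affine chart [z : 1] is [Some z], the point [1 : 0] is [None]. *)
Definition CP1 : Type := option C.

Definition homogeneous_coordinates (w : C * C) (P : CP1) : Prop :=
  match P with
  | Some z => snd w <> RtoC 0 /\ fst w = Cmult z (snd w)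
  | None => fst w <> RtoC 0 /\ snd w = RtoC 0
  end.

(* Stereographic projection from the south pole (0, 0, -1/sqrt|G|) to the plane
   x3 = 0 if G <> 0, which preserves the orientation fixed by [normal]; the
   affine coordinate x1 + i x2 if G = 0. *)
Definition conformal_model (G : R) (p : R3) : CP1 :=
  let h := 1 + sqrt (Rabs G) * x3 p in
  if Req_dec_T h 0 then None else Some ((x1 p / h, x2 p / h) : C).

Definition scale2 (z : C) (w : C * C) : C * C :=
  (Cmult z (fst w), Cmult z (snd w)).

Definition det2 (u v : C * C) : C :=
  Cminus (Cmult (fst u) (snd v)) (Cmult (snd u) (fst v)).

(* [lift] is a lift of g, rescaled by m to [ghat] with det (ghat, ghat') = 1 and
   ghat'' + q ghat = 0; [ghat1] and [ghat2] are the derivatives of [ghat].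
   [is_derive] is here the real derivative of functions of one real variable
   valued in C * C. *)
Definition is_schwarzian (I : R -> Prop) (g : R -> CP1) (q : R -> C) : Prop :=
  exists (lift : R -> C * C) (m : R -> C) (ghat1 ghat2 : R -> C * C),
    let ghat := fun t : R => scale2 (m t) (lift t) in
    forall s : R, I s ->
      homogeneous_coordinates (lift s) (g s) /\
      is_derive ghat s (ghat1 s) /\
      is_derive ghat1 s (ghat2 s) /\
      det2 (ghat s) (ghat1 s) = RtoC 1 /\
      Cplus (fst (ghat2 s)) (Cmult (q s) (fst (ghat s))) = RtoC 0 /\
      Cplus (snd (ghat2 s)) (Cmult (q s) (snd (ghat s))) = RtoC 0.

(** * The stationary mKdV and KdV equations *)

Definition stationary_mKdV (G mu lambda nu : R) (I : R -> Prop)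
    (kappa : R -> R) : Prop :=
  forall s : R, I s ->
    differentiable_at 2 kappa s /\
    Derive_n kappa 2 s + / 2 * kappa s ^ 3 + (mu + G) * kappa s + lambda = 0 /\
    Derive kappa s ^ 2 =
      - / 4 * kappa s ^ 4 - (mu + G) * kappa s ^ 2 - 2 * lambda * kappa s - nu.

Definition stationary_KdV (c d e : R) (I : R -> Prop) (q : R -> C) : Prop :=
  forall s : R, I s ->
    exists q1 : C, is_derive q s q1 /\
      (q1 ^ 2 + 2 * q s ^ 3 + c * q s ^ 2 + 2 * d * q s + e = 0)%C.

(* Main.v *)
(* Idea.  The lift [f = (f1, f2)] of the curve with [det (f, f') = 1] is the spin
   frame of the curve: [f1^2], [f2^2] and [f1 f2] are explicit functions A, B and D
   of the position and of T + iN, where T is the velocity and N = J T.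
   By the Frenet equations T' = kappa N - G p and N' = - kappa T,
     f1' = - (i kappa / 2) f1 - u conj(f2),
     f2' = - (i kappa / 2) f2 + v conj(f1)
   with real constants u, v such that u v = G / 4, and differentiating once more
   gives f'' = - (i kappa' / 2 + kappa^2 / 4 + G / 4) f.  Locally f is a square
   root, determined up to sign; since two such f are equal or opposite on a whole
   interval, the local ones glue.  This works through the point at infinity of
   the sphere, where the affine coordinate breaks down.  Conversely, a lift with
   det = 1 is f up to sign, which gives the uniqueness of q. *)
Require Import Defs.
From Stdlib Require Import Reals Lra Psatz Nsatz Classical ClassicalEpsilon.
From Coquelicot Require Import Coquelicot.

Open Scope R_scope.

(** * Complex-valued functions of a real variable *)

Lemma Csquare_eq (x y : C) : (x * x = y * y)%C -> x = y \/ x = (- y)%C.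
Proof.
  intros H.
  destruct (classic (x - y = 0)%C) as [H1|H1].
  - left; replace x with (x - y + y)%C by ring; rewrite H1; ring.
  - right; destruct (classic (x + y = 0)%C) as [H2|H2].
    + replace x with (x + y - y)%C by ring; rewrite H2; ring.
    + destruct (Cmult_neq_0 _ _ H1 H2).
      replace ((x - y) * (x + y))%C with (x * x - y * y)%C by ring.
      rewrite H; ring.
Qed.

Lemma Cmult_integral (x y : C) : (x * y = 0)%C -> x = 0%C \/ y = 0%C.
Proof.
  intros H; apply NNPP; intros [H1 H2]%not_or_and.
  now destruct (Cmult_neq_0 _ _ H1 H2).
Qed.

Lemma Cmult_reg_l (x y z : C) : x <> 0%C -> (x * y = x * z)%C -> y = z.
Proof.
  intros Hx H.
  assert (H1 : (x * (y - z) = 0)%C).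
  { replace (x * (y - z))%C with (x * y - x * z)%C by ring; rewrite H; ring. }
  destruct (Cmult_integral _ _ H1) as [|H0].
  - contradiction.
  - replace y with (y - z + z)%C by ring; rewrite H0; ring.
Qed.

Lemma Cmult_conj_eq0 (z : C) (r : R) :
  (z * Cconj z = r * r)%C -> z = 0%C -> r = 0.
Proof.
  intros H ->; assert (H1 := f_equal fst H); simpl in H1; nra.
Qed.

Lemma Cconj_square_abs (x y : C) (r : R) :
  (x * x = y)%C -> (y * Cconj y = r * r)%C -> 0 <= r -> (x * Cconj x)%C = r.
Proof.
  intros <- H Hr; destruct x as [a b].
  assert (H1 := f_equal fst H); simpl in H1.
  apply injective_projections; simpl; [|ring].
  assert (0 <= a * a + b * b) by nra.
  assert ((a * a + b * b) * (a * a + b * b) = r * r) by lra.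
  nra.
Qed.

Lemma C2_neq0 : RtoC 2 <> 0%C.
Proof. intros E; assert (H := f_equal fst E); simpl in H; lra. Qed.

(** Serves at two levels: for [C], as pairs of reals, and for [C * C], as pairs of complex
    numbers. *)
Lemma is_derive_pair {U V : NormedModule R_AbsRing} (f : R -> U * V) (s : R)
    (l : U * V) :
  is_derive f s l <->
  is_derive (fun t => fst (f t)) s (fst l) /\
  is_derive (fun t => snd (f t)) s (snd l).
Proof.
  split.
  - intros H; split.
    + apply (filterdiff_comp' f fst s _ (fun x => fst x)) in H; [exact H|].
      apply filterdiff_linear, is_linear_fst.
    + apply (filterdiff_comp' f snd s _ (fun x => snd x)) in H; [exact H|].
      apply filterdiff_linear, is_linear_snd.
  - intros [H1 H2].
    assert (H := filterdiff_comp'_2 (fun t => fst (f t)) (fun t => snd (f t))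
      (fun x y => (x, y)) s _ _ (fun x y => (x, y)) H1 H2).
    eapply filterdiff_ext_lin.
    + eapply filterdiff_ext; [|apply H].
      * intros t; simpl; now destruct (f t).
      (* Pairing the two components is the identity of [U * V], hence its own differential. *)
      * apply (filterdiff_ext (fun x => x)); [now intros []|].
        eapply filterdiff_ext_lin; [apply filterdiff_id|now intros []].
    + now intros y; destruct l.
Qed.

Lemma is_derive_eq {V : NormedModule R_AbsRing} (f : R -> V) (s : R) (l l' : V) :
  is_derive f s l -> l = l' -> is_derive f s l'.
Proof. now intros H <-. Qed.

Lemma is_derive_Cmult (f g : R -> C) (s : R) (lf lg : C) :
  is_derive f s lf -> is_derive g s lg ->
  is_derive (fun t => (f t * g t)%C) s (lf * g s + f s * lg)%C.
Proof.
  intros [F1 F2]%is_derive_pair [G1 G2]%is_derive_pair.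
  apply is_derive_pair; split.
  - eapply is_derive_eq.
    + exact (is_derive_minus _ _ _ _ _
        (is_derive_mult _ _ _ _ _ F1 G1 Rmult_comm)
        (is_derive_mult _ _ _ _ _ F2 G2 Rmult_comm)).
    + compute; ring.
  - eapply is_derive_eq.
    + exact (is_derive_plus _ _ _ _ _
        (is_derive_mult _ _ _ _ _ F1 G2 Rmult_comm)
        (is_derive_mult _ _ _ _ _ F2 G1 Rmult_comm)).
    + compute; ring.
Qed.

Lemma is_derive_Cplus (f g : R -> C) (s : R) (lf lg : C) :
  is_derive f s lf -> is_derive g s lg ->
  is_derive (fun t => (f t + g t)%C) s (lf + lg)%C.
Proof. apply (is_derive_plus (V := C_R_NormedModule)). Qed.

Lemma is_derive_Cconj (f : R -> C) (s : R) (l : C) :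
  is_derive f s l -> is_derive (fun t => Cconj (f t)) s (Cconj l).
Proof.
  intros [F1 F2]%is_derive_pair; apply is_derive_pair; simpl; split; [easy|].
  now apply (is_derive_opp (fun t => snd (f t))).
Qed.

Lemma is_derive_RtoC (f : R -> R) (s l : R) :
  is_derive f s l -> is_derive (fun t => RtoC (f t)) s (RtoC l).
Proof.
  intros F; apply is_derive_pair; simpl; split; [easy|].
  apply (is_derive_const (V := R_NormedModule)).
Qed.

Lemma is_derive_Cconst (c : C) (s : R) :
  is_derive (fun _ : R => c) s (RtoC 0).
Proof. apply (is_derive_const (V := C_R_NormedModule)). Qed.

Lemma is_derive_C_unique (f : R -> C) (s : R) (l l' : C) :
  is_derive f s l -> is_derive f s l' -> l = l'.
Proof.
  intros [F1 F2]%is_derive_pair [G1 G2]%is_derive_pair.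
  apply injective_projections; etransitivity;
    [symmetry| |symmetry|]; apply is_derive_unique; eassumption.
Qed.

Lemma ex_derive_C (f : R -> C) (s : R) :
  ex_derive f s <->
  ex_derive (fun t => fst (f t)) s /\ ex_derive (fun t => snd (f t)) s.
Proof.
  split.
  - intros [l [H1 H2]%is_derive_pair]; split; eexists; eassumption.
  - intros [[l1 H1] [l2 H2]]; exists (l1, l2); now apply is_derive_pair.
Qed.

Lemma ex_derive_pair {U V : NormedModule R_AbsRing} (f : R -> U * V) (s : R) :
  ex_derive (fun t => fst (f t)) s -> ex_derive (fun t => snd (f t)) s ->
  ex_derive f s.
Proof.
  intros [l1 H1] [l2 H2]; exists (l1, l2); now apply is_derive_pair.
Qed.

Lemma ex_derive_Cmult (f g : R -> C) (s : R) :
  ex_derive f s -> ex_derive g s -> ex_derive (fun t => (f t * g t)%C) s.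
Proof. intros [l H] [l' H']; eexists; apply is_derive_Cmult; eassumption. Qed.

Lemma ex_derive_Cinv (f : R -> C) (s : R) :
  ex_derive f s -> f s <> 0%C -> ex_derive (fun t => (/ f t)%C) s.
Proof.
  intros [H1 H2]%ex_derive_C Hs.
  set (x := fun t => fst (f t)) in *; set (y := fun t => snd (f t)) in *.
  assert (Hn : x s * x s + y s * y s <> 0).
  { intros H; apply Hs, injective_projections;
      [change (x s = 0)|change (y s = 0)]; nra. }
  apply ex_derive_C; split.
  - change (ex_derive (fun t => x t / (x t ^ 2 + y t ^ 2)) s).
    auto_derive; simpl; repeat split; auto; nra.
  - change (ex_derive (fun t => - y t / (x t ^ 2 + y t ^ 2)) s).
    auto_derive; simpl; repeat split; auto; nra.
Qed.

Lemma is_derive_C2_unique (f : R -> C * C) (s : R) (l l' : C * C) :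
  is_derive f s l -> is_derive f s l' -> l = l'.
Proof.
  intros [F1 F2]%is_derive_pair [G1 G2]%is_derive_pair.
  apply injective_projections; eapply is_derive_C_unique; eassumption.
Qed.

(** * Gluing of spinors along an interval *)

Lemma locally_Rbar_interval (a b : Rbar) (s : R) :
  Rbar_interval a b s -> locally s (Rbar_interval a b).
Proof.
  intros [Ha Hb].
  apply (open_and _ _ (open_Rbar_gt a) (open_Rbar_lt b)); now split.
Qed.

Lemma Rbar_interval_convex (a b : Rbar) (s t x : R) :
  Rbar_interval a b s -> Rbar_interval a b t -> s <= x <= t ->
  Rbar_interval a b x.
Proof.
  intros [Ha _] [_ Hb] [Hs Ht]; split.
  - now apply Rbar_lt_le_trans with s.
  - now apply Rbar_le_lt_trans with t.
Qed.

(** Connectedness of an interval, for an equivalence with open classes. The supremum of the points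
    of [s, t] related to [s] is itself related to [s], and it must be [t] because its neighbourhood
    reaches further. This serves both to compare two spinors and to extend one. *)
Lemma interval_connected (a b : Rbar) (E : R -> R -> Prop) :
  (forall s t, E s t -> E t s) ->
  (forall s t x, E s t -> E t x -> E s x) ->
  (forall s, Rbar_interval a b s -> locally s (E s)) ->
  forall s t, Rbar_interval a b s -> Rbar_interval a b t -> E s t.
Proof.
  intros Esym Etrans Eloc.
  assert (Hle : forall s t, Rbar_interval a b s -> Rbar_interval a b t ->
    s <= t -> E s t).
  { intros s t Is It Hst.
    assert (Es : E s s) by exact (locally_singleton _ _ (Eloc s Is)).
    destruct (completeness (fun x => s <= x <= t /\ E s x)) as [m [Hub Hlub]].
    { exists t; intros x [Hx _]; lra. }
    { exists s; split; [lra|easy]. }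
    assert (Hsm : s <= m) by (apply Hub; split; [lra|easy]).
    assert (Hmt : m <= t) by (apply Hlub; intros x [Hx _]; lra).
    assert (Im : Rbar_interval a b m)
      by (now apply (Rbar_interval_convex a b s t)).
    destruct (Eloc m Im) as [eps Heps].
    (* Otherwise [m - eps] would be a smaller upper bound. *)
    assert (Hx : exists x, m - eps < x /\ s <= x <= t /\ E s x).
    { apply NNPP; intros Hn.
      assert (m <= m - eps); [|destruct eps; simpl in *; lra].
      apply Hlub; intros x Hx; apply Rnot_lt_le; intros Hlt; apply Hn.
      now exists x. }
    destruct Hx as (x & Hmx & Hx & Ex).
    assert (Hxm : x <= m) by (now apply Hub).
    assert (Em : E s m).
    { apply Etrans with x; [easy|]; apply Esym, Heps.
      change (Rabs (x - m) < eps); apply Rabs_def1; lra. }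
    destruct (Req_dec m t) as [<-|Hne]; [easy|exfalso].
    set (y := Rmin t (m + eps / 2)).
    assert (Heps0 := cond_pos eps).
    assert (Hy : m < y <= t /\ y <= m + eps / 2)
      by (unfold y, Rmin; destruct (Rle_dec t (m + eps / 2)); lra).
    assert (y <= m); [|lra].
    apply Hub; split; [lra|].
    apply Etrans with m; [easy|]; apply Heps.
    change (Rabs (y - m) < eps); apply Rabs_def1; lra. }
  intros s t Is It; destruct (Rle_or_lt s t).
  - now apply Hle.
  - apply Esym, Hle; auto; lra.
Qed.

(** * Local differentiable square roots of complex functions *)

Lemma locally_gt0 (f : R -> R) (s : R) :
  ex_derive f s -> 0 < f s -> locally s (fun t => 0 < f t).
Proof.
  intros H1 H2; apply ex_derive_continuous in H1.
  now apply (H1 (fun y => 0 < y)), open_gt.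
Qed.

(** The root in the right half plane: squaring p + iq gives 2 p^2 = |z| + Re z and 2 p q = Im z. The
    condition 0 < |z| + Re z, under which it is used, excludes exactly the nonpositive reals. *)
Definition principal_sqrt (z : C) : C :=
  let p := sqrt ((sqrt (fst z ^ 2 + snd z ^ 2) + fst z) / 2) in
  (p, snd z / (2 * p)).

Lemma principal_sqrt_correct (z : C) :
  0 < sqrt (fst z ^ 2 + snd z ^ 2) + fst z ->
  (principal_sqrt z * principal_sqrt z)%C = z.
Proof.
  destruct z as [x y]; unfold principal_sqrt; simpl fst; simpl snd; intros H.
  set (r := sqrt (x ^ 2 + y ^ 2)) in *.
  set (p := sqrt ((r + x) / 2)).
  assert (Hr : r * r = x ^ 2 + y ^ 2) by (apply sqrt_sqrt; nra).
  assert (Hp : p * p = (r + x) / 2) by (apply sqrt_sqrt; lra).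
  assert (Hp0 : 0 < p) by (apply sqrt_lt_R0; lra).
  apply injective_projections; simpl; [|field; lra].
  replace (y / (2 * p) * (y / (2 * p))) with ((y ^ 2 / 2) / (2 * (p * p)))
    by (field; lra).
  rewrite Hp; replace (y ^ 2) with (r * r - x ^ 2) by lra; field; lra.
Qed.

Lemma ex_derive_principal_sqrt (x y : R -> R) (s : R) :
  ex_derive x s -> ex_derive y s ->
  0 < sqrt (x s ^ 2 + y s ^ 2) + x s ->
  ex_derive (fun t => sqrt (x t ^ 2 + y t ^ 2) + x t) s /\
  ex_derive (fun t => principal_sqrt (x t, y t)) s.
Proof.
  intros Hx Hy Hs.
  assert (Hn : 0 < x s ^ 2 + y s ^ 2).
  { destruct (Rle_or_lt (x s ^ 2 + y s ^ 2) 0) as [H|H]; [|easy].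
    rewrite sqrt_neg_0 in Hs by easy; nra. }
  assert (Hp : 0 < sqrt ((sqrt (x s ^ 2 + y s ^ 2) + x s) / 2))
    by (apply sqrt_lt_R0; lra).
  split; [|apply ex_derive_C; unfold principal_sqrt; simpl fst; simpl snd; split];
    auto_derive; simpl in *; repeat split; auto; lra.
Qed.

Lemma local_sqrt_principal (w : R -> C) (s : R) :
  locally s (ex_derive w) ->
  0 < sqrt (fst (w s) ^ 2 + snd (w s) ^ 2) + fst (w s) ->
  exists f : R -> C,
    locally s (fun t => (f t * f t)%C = w t /\ ex_derive f t).
Proof.
  set (x := fun t => fst (w t)); set (y := fun t => snd (w t)).
  intros Hw Hs; exists (fun t => principal_sqrt (x t, y t)).
  change (0 < sqrt (x s ^ 2 + y s ^ 2) + x s) in Hs.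
  assert (Hpos : locally s (fun t => 0 < sqrt (x t ^ 2 + y t ^ 2) + x t)).
  { apply locally_singleton, ex_derive_C in Hw.
    apply locally_gt0 with (f := fun t => sqrt (x t ^ 2 + y t ^ 2) + x t);
      [|easy].
    now apply (ex_derive_principal_sqrt x y s). }
  generalize (filter_and _ _ Hw Hpos); apply filter_imp; intros t [Ht1 Ht2].
  apply ex_derive_C in Ht1; split.
  - now rewrite principal_sqrt_correct by easy; unfold x, y; destruct (w t).
  - now apply ex_derive_principal_sqrt.
Qed.

(** Off the nonpositive reals the principal root works. A nonzero value on that cut is a negative
    real, so [- w] avoids the cut nearby, and [Ci] times the principal root of [- w] is a root of
    [w]. *)
Lemma local_sqrt (w : R -> C) (s : R) :
  locally s (ex_derive w) -> w s <> 0%C ->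
  exists f : R -> C,
    locally s (fun t => (f t * f t)%C = w t /\ ex_derive f t).
Proof.
  intros Hw Hs.
  destruct (Rlt_or_le 0 (sqrt (fst (w s) ^ 2 + snd (w s) ^ 2) + fst (w s))) as [H|H].
  { now apply local_sqrt_principal. }
  assert (Hneg : fst (w s) < 0).
  { assert (H1 := sqrt_pos (fst (w s) ^ 2 + snd (w s) ^ 2)).
    destruct (Req_dec (fst (w s)) 0) as [H0|H0]; [exfalso|lra].
    assert (H2 : sqrt (fst (w s) ^ 2 + snd (w s) ^ 2) = 0) by lra.
    apply sqrt_eq_0 in H2; [|nra].
    apply Hs, injective_projections; simpl; nra. }
  assert (Hopp : forall t, ex_derive w t -> ex_derive (fun t => Copp (w t)) t).
  { intros t Ht; now apply (ex_derive_opp (V := C_R_NormedModule)). }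
  destruct (local_sqrt_principal (fun t => Copp (w t)) s) as [f Hf].
  - revert Hw; now apply filter_imp.
  - simpl; match goal with |- 0 < sqrt ?x + _ => assert (H1 := sqrt_pos x) end.
    lra.
  - exists (fun t => (Ci * f t)%C); revert Hf; apply filter_imp.
    intros t [Ht1 [l Ht2]]; split.
    + replace (w t) with (- - w t)%C by ring; rewrite <- Ht1.
      apply injective_projections; simpl; ring.
    + eexists; apply is_derive_Cmult; [|exact Ht2].
      apply is_derive_Cconst.
Qed.

(** The two squares alone would leave the relative sign of the components free; the product [D]
    fixes it, so that only a common sign remains. Being nonzero keeps the two choices apart, and
    differentiability prevents jumps between them. *)
Definition is_spinor (A B D : R -> C) (f : R -> C * C) (t : R) : Prop :=
  (fst (f t) * fst (f t))%C = A t /\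
  (snd (f t) * snd (f t))%C = B t /\
  (fst (f t) * snd (f t))%C = D t /\
  f t <> (RtoC 0, RtoC 0) /\
  ex_derive f t.

Lemma is_spinor_sign (A B D : R -> C) (f g : R -> C * C) (t : R) :
  is_spinor A B D f t -> is_spinor A B D g t ->
  f t = g t \/ f t = scale2 (- (1))%C (g t).
Proof.
  intros (F1 & F2 & F3 & F4 & _) (G1 & G2 & G3 & G4 & _).
  unfold scale2; destruct (f t) as [x y], (g t) as [x' y']; simpl in *.
  rewrite <- G1 in F1; rewrite <- G2 in F2; rewrite <- G3 in F3.
  clear A B D G1 G2 G3.
  assert (H : forall x y x' y' : C, (x * x = x' * x')%C -> (x * y = x' * y')%C ->
    x <> 0%C -> (x, y) = (x', y') \/ (x, y) = (- (1) * x', - (1) * y')%C).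
  { clear; intros x y x' y' F1 F3 Hx.
    destruct (Csquare_eq _ _ F1) as [->| ->]; [left|right]; f_equal.
    - apply (Cmult_reg_l x'); easy.
    - ring.
    - apply (Cmult_reg_l (- x')%C); [easy|]; rewrite F3; ring. }
  destruct (classic (x = 0%C)) as [->|Hx]; [|now auto].
  destruct (classic (y = 0%C)) as [->|Hy]; [easy|].
  (* With a zero first component, the same argument runs with the components exchanged. *)
  assert (F5 : (y * 0 = y' * x')%C) by (rewrite Cmult_comm, F3; ring).
  destruct (H y 0%C y' x' F2 F5 Hy) as [E|E];
    assert (E1 := f_equal fst E); assert (E2 := f_equal snd E); simpl in E1, E2;
    [left|right]; f_equal; assumption.
Qed.

Lemma ex_derive_scale2 (c : C) (f : R -> C * C) (t : R) :
  ex_derive f t -> ex_derive (fun s => scale2 c (f s)) t.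
Proof.
  intros [l [H1 H2]%is_derive_pair].
  exists (scale2 c l); apply is_derive_pair; split.
  - eapply is_derive_eq; [apply (is_derive_Cmult (fun _ => c))|].
    + apply is_derive_Cconst.
    + exact H1.
    + change (0 * fst (f t) + c * fst l = c * fst l)%C; ring.
  - eapply is_derive_eq; [apply (is_derive_Cmult (fun _ => c))|].
    + apply is_derive_Cconst.
    + exact H2.
    + change (0 * snd (f t) + c * snd l = c * snd l)%C; ring.
Qed.

Lemma is_spinor_opp (A B D : R -> C) (f : R -> C * C) (t : R) :
  is_spinor A B D f t -> is_spinor A B D (fun s => scale2 (- (1))%C (f s)) t.
Proof.
  intros (F1 & F2 & F3 & F4 & F5).
  refine (conj _ (conj _ (conj _ (conj _ _)))).
  - rewrite <- F1; unfold scale2; cbn [fst snd]; ring.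
  - rewrite <- F2; unfold scale2; cbn [fst snd]; ring.
  - rewrite <- F3; unfold scale2; cbn [fst snd]; ring.
  - intros H; apply F4; destruct (f t) as [x y]; unfold scale2 in H; cbn [fst snd] in H.
    assert (Hx := f_equal fst H); assert (Hy := f_equal snd H).
    cbn [fst snd] in Hx, Hy; f_equal.
    + replace x with (- (- (1) * x))%C by ring; rewrite Hx; ring.
    + replace y with (- (- (1) * y))%C by ring; rewrite Hy; ring.
  - now apply ex_derive_scale2.
Qed.

Lemma is_spinor_ext_loc (A B D : R -> C) (f g : R -> C * C) (t : R) :
  locally t (fun s => f s = g s) ->
  is_spinor A B D f t -> is_spinor A B D g t.
Proof.
  intros E; unfold is_spinor; rewrite (locally_singleton _ _ E).
  intros (F1 & F2 & F3 & F4 & F5).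
  refine (conj F1 (conj F2 (conj F3 (conj F4 _)))).
  now apply (ex_derive_ext_loc f).
Qed.

(* Real part of the Hermitian product: it is [|w|^2] if [z = w] and [-|w|^2] if
   [z = -w], so that its sign detects which of two opposite spinors is taken. *)
Definition re_hermitian (z w : C * C) : R :=
  fst (fst z) * fst (fst w) + snd (fst z) * snd (fst w) +
  (fst (snd z) * fst (snd w) + snd (snd z) * snd (snd w)).

Lemma ex_derive_re_hermitian (f g : R -> C * C) (t : R) :
  ex_derive f t -> ex_derive g t ->
  ex_derive (fun s => re_hermitian (f s) (g s)) t.
Proof.
  intros [l [[F1 F2]%is_derive_pair [F3 F4]%is_derive_pair]%is_derive_pair].
  intros [l' [[G1 G2]%is_derive_pair [G3 G4]%is_derive_pair]%is_derive_pair].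
  eexists; refine (is_derive_plus _ _ _ _ _
    (is_derive_plus _ _ _ _ _
      (is_derive_mult _ _ _ _ _ F1 G1 Rmult_comm)
      (is_derive_mult _ _ _ _ _ F2 G2 Rmult_comm))
    (is_derive_plus _ _ _ _ _
      (is_derive_mult _ _ _ _ _ F3 G3 Rmult_comm)
      (is_derive_mult _ _ _ _ _ F4 G4 Rmult_comm))).
Qed.

Lemma re_hermitian_pos (z : C * C) :
  z <> (RtoC 0, RtoC 0) -> 0 < re_hermitian z z.
Proof.
  destruct z as [[x y] [x' y']]; unfold re_hermitian; simpl; intros H.
  apply Rnot_le_lt; intros H1; apply H.
  unfold RtoC; repeat f_equal; nra.
Qed.

Lemma re_hermitian_opp (z w : C * C) :
  re_hermitian (scale2 (- (1))%C z) w = - re_hermitian z w.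
Proof. unfold re_hermitian, scale2; simpl; ring. Qed.

(** At each point the spinors are equal or opposite. There [re_hermitian (f t) (g t)] is |g|^2 or
    -|g|^2, nonzero, and it is continuous, so the sign is locally constant and [interval_connected]
    makes it constant. *)
Lemma is_spinor_unique (A B D : R -> C) (a b : Rbar) (f g : R -> C * C)
    (x y : R) :
  (forall t, Rbar_interval a b t -> is_spinor A B D f t) ->
  (forall t, Rbar_interval a b t -> is_spinor A B D g t) ->
  Rbar_interval a b x -> Rbar_interval a b y ->
  f x = g x -> f y = g y.
Proof.
  intros Hf Hg Ix Iy.
  enough (E : f x = g x <-> f y = g y) by apply E.
  apply (interval_connected a b (fun s t => f s = g s <-> f t = g t));
    [tauto|tauto| |easy|easy].
  clear x y Ix Iy; intros s Is.
  assert (HI := locally_Rbar_interval a b s Is).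
  assert (Hd : forall t, Rbar_interval a b t ->
    ex_derive (fun t => re_hermitian (f t) (g t)) t).
  { intros t It; apply ex_derive_re_hermitian; [apply (Hf t It)|apply (Hg t It)]. }
  assert (Hpos : forall t, Rbar_interval a b t -> 0 < re_hermitian (g t) (g t))
    by (intros t It; apply re_hermitian_pos, (Hg t It)).
  assert (Hp := Hpos s Is).
  destruct (is_spinor_sign _ _ _ _ _ _ (Hf s Is) (Hg s Is)) as [E|E].
  - assert (H : locally s (fun t => 0 < re_hermitian (f t) (g t)))
      by (apply locally_gt0; [now apply Hd|now rewrite E]).
    generalize (filter_and _ _ HI H); apply filter_imp; intros t [It Ht].
    destruct (is_spinor_sign _ _ _ _ _ _ (Hf t It) (Hg t It)) as [E'|E'];
      [tauto|].
    rewrite E', re_hermitian_opp in Ht; specialize (Hpos t It); lra.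
  - assert (H : locally s (fun t => 0 < - re_hermitian (f t) (g t))).
    { apply locally_gt0; [now apply (ex_derive_opp (fun t => re_hermitian (f t) (g t))), Hd|].
      rewrite E, re_hermitian_opp; lra. }
    generalize (filter_and _ _ HI H); apply filter_imp; intros t [It Ht].
    split; intros E'; exfalso.
    + rewrite E' in E.
      assert (H1 := f_equal (fun z => re_hermitian z (g s)) E); simpl in H1.
      rewrite re_hermitian_opp in H1; lra.
    + rewrite E' in Ht; specialize (Hpos t It); lra.
Qed.

(** The endpoints are real numbers, so that overlaps and unions of intervals are expressed by [Rmax]
    and [Rmin]. *)
Definition spinor_connected (A B D : R -> C) (x y : R) : Prop :=
  exists (c d : R) (f : R -> C * C),
    Rbar_interval c d x /\ Rbar_interval c d y /\
    forall t, Rbar_interval c d t -> is_spinor A B D f t.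

(** After a change of sign the two spinors agree at [y], hence on the whole overlap by uniqueness,
    and can be patched together. *)
Lemma spinor_connected_trans (A B D : R -> C) (x y z : R) :
  spinor_connected A B D x y -> spinor_connected A B D y z ->
  spinor_connected A B D x z.
Proof.
  intros (c & d & f & Ix & Iy & Hf) (c' & d' & g & Iy' & Iz & Hg).
  assert (Hg' : exists g', g' y = f y /\
    forall t, Rbar_interval c' d' t -> is_spinor A B D g' t).
  { destruct (is_spinor_sign _ _ _ _ _ _ (Hf y Iy) (Hg y Iy')) as [E|E].
    - now exists g.
    - exists (fun s => scale2 (- (1))%C (g s)); split; [easy|].
      intros t It; now apply is_spinor_opp, Hg. }
  clear g Hg; destruct Hg' as (g & E & Hg).
  assert (Hfg : forall t, Rbar_interval c d t -> Rbar_interval c' d' t ->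
    f t = g t).
  { intros t It It'.
    unfold Rbar_interval in *; simpl in *.
    apply (is_spinor_unique A B D (Rmax c c') (Rmin d d') f g y t);
      [intros u Hu; apply Hf|intros u Hu; apply Hg| | |easy];
      unfold Rbar_interval in *; simpl in *;
      unfold Rmax, Rmin in *; destruct (Rle_dec c c'), (Rle_dec d d'); lra. }
  set (h := fun t => if excluded_middle_informative (Rbar_interval c d t)
    then f t else g t).
  assert (Hh : forall t, Rbar_interval c' d' t -> h t = g t).
  { intros t It; unfold h.
    destruct excluded_middle_informative; auto. }
  exists (Rmin c c'), (Rmax d d'), h.
  (* The union is an interval because both intervals contain [y]. *)
  assert (Hcase : forall t, Rbar_interval (Rmin c c') (Rmax d d') t ->
    Rbar_interval c d t \/ Rbar_interval c' d' t).
  { intros u; unfold Rbar_interval in *; simpl in *.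
    unfold Rmax, Rmin; destruct (Rle_dec c c'), (Rle_dec d d');
      destruct (Rle_or_lt u y); intros; lra. }
  split; [|split]; try (unfold Rbar_interval in *; simpl in *;
    unfold Rmax, Rmin; destruct (Rle_dec c c'), (Rle_dec d d'); lra).
  intros t It; destruct (Hcase t It) as [H|H].
  - apply (is_spinor_ext_loc A B D f); [|now apply Hf].
    apply locally_Rbar_interval in H; revert H; apply filter_imp.
    intros s Is; unfold h; now destruct excluded_middle_informative.
  - apply (is_spinor_ext_loc A B D g); [|now apply Hg].
    apply locally_Rbar_interval in H; revert H; apply filter_imp.
    intros s Is; symmetry; now apply Hh.
Qed.

(** Every point shares with a base point [s0] an interval that carries a spinor. Prescribing the
    value at [s0] removes the sign ambiguity, so these spinors are compatible. *)
Lemma global_spinor (A B D : R -> C) (a b : Rbar) :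
  (forall s, Rbar_interval a b s ->
    exists f, locally s (is_spinor A B D f)) ->
  exists f, forall s, Rbar_interval a b s -> is_spinor A B D f s.
Proof.
  intros Hloc.
  destruct (classic (exists s, Rbar_interval a b s)) as [[s0 I0]|Hn];
    [|exists (fun _ => (RtoC 0, RtoC 0)); intros s Is; destruct Hn; now exists s].
  assert (Hcon : forall t, Rbar_interval a b t -> spinor_connected A B D s0 t).
  { intros t It; apply (interval_connected a b); try easy.
    - intros s u (c & d & f & Is & Iu & Hf); now exists c, d, f.
    - apply spinor_connected_trans.
    - intros s Is; destruct (Hloc s Is) as [f [eps Hf]].
      exists eps; intros u Hu; exists (s - eps), (s + eps), f.
      assert (Heps := cond_pos eps).
      apply Rabs_def2 in Hu; unfold minus, plus, opp in Hu; simpl in Hu.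
      unfold Rbar_interval; simpl; split; [lra|split; [lra|]].
      intros v Hv; apply Hf; apply Rabs_def1; unfold minus, plus, opp; simpl; lra. }
  destruct (Hloc s0 I0) as [f0 H0]; apply locally_singleton in H0.
  (* Membership in the interval stands below the existential, so that choice yields a function of
     every real [t]. *)
  assert (Hnorm : forall t, exists f, Rbar_interval a b t ->
    f s0 = f0 s0 /\ exists c d : R, Rbar_interval c d s0 /\ Rbar_interval c d t /\
    forall u, Rbar_interval c d u -> is_spinor A B D f u).
  { intros t; destruct (classic (Rbar_interval a b t)) as [It|]; [|now exists f0].
    destruct (Hcon t It) as (c & d & f & Is & Iu & Hf).
    destruct (is_spinor_sign _ _ _ _ _ _ H0 (Hf s0 Is)) as [E|E].
    - exists f; intros _; split; [easy|]; now exists c, d.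
    - exists (fun s => scale2 (- (1))%C (f s)); intros _; split; [easy|].
      exists c, d; split; [easy|split; [easy|]].
      intros v Hv; now apply is_spinor_opp, Hf. }
  set (F := fun t => proj1_sig (constructive_indefinite_description _ (Hnorm t))).
  assert (HF : forall t, Rbar_interval a b t ->
    F t s0 = f0 s0 /\ exists c d : R, Rbar_interval c d s0 /\ Rbar_interval c d t /\
    forall u, Rbar_interval c d u -> is_spinor A B D (F t) u)
    by (intros t; exact (proj2_sig (constructive_indefinite_description _ (Hnorm t)))).
  clearbody F; clear Hnorm Hcon H0 Hloc.
  (* For [u] near [t], the spinors [F u] and [F t] coincide at [s0], hence also at [u]; thus the
     diagonal equals [F t] near [t] and inherits its derivative. *)
  exists (fun t => F t t); intros t It.
  destruct (HF t It) as (E & c & d & Is & Ic & Hf).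
  apply (is_spinor_ext_loc A B D (F t)); [|now apply Hf].
  generalize (filter_and _ _ (locally_Rbar_interval a b t It)
    (locally_Rbar_interval c d t Ic)); apply filter_imp.
  intros u [Iu Ju].
  destruct (HF u Iu) as (E' & c' & d' & Is' & Ic' & Hf').
  unfold Rbar_interval in Is, Ic, Ju, Is', Ic'; simpl in Is, Ic, Ju, Is', Ic'.
  apply (is_spinor_unique A B D (Rmax c c') (Rmin d d') (F t) (F u) s0 u);
    [intros v Hv; apply Hf|intros v Hv; apply Hf'| | |congruence];
    unfold Rbar_interval in *; simpl in *;
    unfold Rmax, Rmin in *; destruct (Rle_dec c c'), (Rle_dec d d'); lra.
Qed.

(** * The differential equation of a spinor *)

(* For a spinor [f] with [f1^2 = A], [f2^2 = B] and [f1 f2 = D], the functions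
   [alpha], [beta] and [zeta] are [|f1|^2], [|f2|^2] and [f1 conj(f2)], and the
   derivatives of [A], [B] and [D] are those forced by [spinor_velocity].  The
   constants satisfy [u v = G / 4]. *)
Record spinor_data (A B D zeta : R -> C)
    (alpha beta kappa : R -> R) (u v : R) (s : R) : Prop := {
  spinor_AB : (A s * B s = D s * D s)%C;
  spinor_A : (A s * Cconj (A s) = alpha s * alpha s)%C;
  spinor_B : (B s * Cconj (B s) = beta s * beta s)%C;
  spinor_alpha : 0 <= alpha s;
  spinor_beta : 0 <= beta s;
  spinor_D : (D s * beta s = zeta s * B s)%C;
  spinor_zeta : (zeta s * Cconj (zeta s) = alpha s * beta s)%C;
  spinor_norm : u * beta s + v * alpha s = 1;
  spinor_dA : is_derive A s (- (Ci * kappa s * A s) - 2 * u * zeta s)%C;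
  spinor_dB : is_derive B s (- (Ci * kappa s * B s) + 2 * v * Cconj (zeta s))%C;
  spinor_dD : is_derive D s (- (Ci * kappa s * D s) + v * alpha s - u * beta s)%C;
  spinor_kappa : ex_derive kappa s
}.
Arguments spinor_AB {_ _ _ _ _ _ _ _ _ _} _.
Arguments spinor_A {_ _ _ _ _ _ _ _ _ _} _.
Arguments spinor_B {_ _ _ _ _ _ _ _ _ _} _.
Arguments spinor_alpha {_ _ _ _ _ _ _ _ _ _} _.
Arguments spinor_beta {_ _ _ _ _ _ _ _ _ _} _.
Arguments spinor_D {_ _ _ _ _ _ _ _ _ _} _.
Arguments spinor_zeta {_ _ _ _ _ _ _ _ _ _} _.
Arguments spinor_norm {_ _ _ _ _ _ _ _ _ _} _.
Arguments spinor_dA {_ _ _ _ _ _ _ _ _ _} _.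
Arguments spinor_dB {_ _ _ _ _ _ _ _ _ _} _.
Arguments spinor_dD {_ _ _ _ _ _ _ _ _ _} _.
Arguments spinor_kappa {_ _ _ _ _ _ _ _ _ _} _.

Lemma locally_C_neq0 (f : R -> C) (s : R) :
  ex_derive f s -> f s <> 0%C -> locally s (fun t => f t <> 0%C).
Proof.
  intros [H1 H2]%ex_derive_C Hs.
  set (x := fun t => fst (f t)) in *; set (y := fun t => snd (f t)) in *.
  assert (H : locally s (fun t => 0 < x t * x t + y t * y t)).
  { apply locally_gt0 with (f := fun t => x t * x t + y t * y t).
    - auto_derive; repeat split; auto.
    - apply Rnot_le_lt; intros H; apply Hs, injective_projections;
        [change (x s = 0)|change (y s = 0)]; nra. }
  revert H; apply filter_imp; intros t Ht E.
  assert (Ex : x t = 0) by (unfold x; now rewrite E).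
  assert (Ey : y t = 0) by (unfold y; now rewrite E).
  rewrite Ex, Ey in Ht; lra.
Qed.

Definition spinor_velocity (kappa : R -> R) (u v : R) (f : R -> C * C)
    (s : R) : C * C :=
  (- (Ci * kappa s / 2) * fst (f s) - u * Cconj (snd (f s)),
   - (Ci * kappa s / 2) * snd (f s) + v * Cconj (fst (f s)))%C.

Section SpinorData.
Context {A B D zeta : R -> C} {alpha beta kappa : R -> R}
  {u v : R}.

Local Notation data := (spinor_data A B D zeta alpha beta kappa u v).

Lemma spinor_data_ex_derive s :
  data s -> ex_derive A s /\ ex_derive B s /\ ex_derive D s.
Proof.
  intros H; split; [|split]; eexists;
    [apply (spinor_dA H)
    |apply (spinor_dB H)
    |apply (spinor_dD H)].
Qed.

(** By [spinor_norm], [A] and [B] have no common zero. A root of the one that does not vanish gives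
    one component, and dividing [D] by it gives the other. *)
Lemma local_spinor s : locally s data -> exists f, locally s (is_spinor A B D f).
Proof.
  intros Hl.
  assert (Hd : locally s (fun t => ex_derive A t /\ ex_derive B t /\ ex_derive D t))
    by (revert Hl; apply filter_imp, spinor_data_ex_derive).
  assert (H := locally_singleton _ _ Hl); assert (Hds := locally_singleton _ _ Hd).
  (* For a curve, [beta] is the denominator [h] of [conformal_model], so [B s = 0] is the passage
     through the point at infinity. *)
  destruct (classic (B s = 0%C)) as [EB|NB].
  - assert (NA : A s <> 0%C).
    { intros EA.
      assert (E1 := Cmult_conj_eq0 _ _ (spinor_A H) EA).
      assert (E2 := Cmult_conj_eq0 _ _ (spinor_B H) EB).
      assert (E3 := spinor_norm H).
      rewrite E1, E2 in E3; lra. }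
    destruct (local_sqrt A s) as [f Hf]; [|easy|].
    { revert Hd; apply filter_imp; tauto. }
    exists (fun t => (f t, D t * / f t)%C).
    generalize (filter_and _ _ Hl (filter_and _ _ Hd (filter_and _ _ Hf
      (locally_C_neq0 _ _ (proj1 Hds) NA)))); apply filter_imp.
    intros t [Ht [(dA & dB & dD) [[Ef df] Nt]]].
    assert (Nf : f t <> 0%C) by (intros E; apply Nt; rewrite <- Ef, E; ring).
    refine (conj _ (conj _ (conj _ (conj _ _)))); cbn [fst snd].
    + easy.
    + assert (E := spinor_AB Ht).
      replace (D t * / f t * (D t * / f t))%C with (D t * D t / (f t * f t))%C
        by (now field).
      rewrite <- E, Ef; now field.
    + now field.
    + intros E; apply Nf, (f_equal fst E).
    + apply ex_derive_pair; cbn [fst snd]; [easy|].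
      apply ex_derive_Cmult; [easy|]; now apply ex_derive_Cinv.
  - destruct (local_sqrt B s) as [f Hf]; [|easy|].
    { revert Hd; apply filter_imp; tauto. }
    exists (fun t => (D t * / f t, f t)%C).
    generalize (filter_and _ _ Hl (filter_and _ _ Hd (filter_and _ _ Hf
      (locally_C_neq0 _ _ (proj1 (proj2 Hds)) NB)))); apply filter_imp.
    intros t [Ht [(dA & dB & dD) [[Ef df] Nt]]].
    assert (Nf : f t <> 0%C) by (intros E; apply Nt; rewrite <- Ef, E; ring).
    refine (conj _ (conj _ (conj _ (conj _ _)))); cbn [fst snd].
    + assert (E := spinor_AB Ht).
      replace (D t * / f t * (D t * / f t))%C with (D t * D t / (f t * f t))%C
        by (now field).
      rewrite <- E, Ef; now field.
    + easy.
    + now field.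
    + intros E; apply Nf, (f_equal snd E).
    + apply ex_derive_pair; cbn [fst snd]; [|easy].
      apply ex_derive_Cmult; [easy|]; now apply ex_derive_Cinv.
Qed.

(** The moduli follow from those of the squares. Where the second component y is nonzero, [spinor_D]
    divided by y^2 yields [zeta]; where y = 0, [spinor_zeta] forces [zeta] to vanish. *)
Lemma spinor_products s f :
  data s -> is_spinor A B D f s ->
  (fst (f s) * Cconj (fst (f s)) = alpha s)%C /\
  (snd (f s) * Cconj (snd (f s)) = beta s)%C /\
  (fst (f s) * Cconj (snd (f s)) = zeta s)%C.
Proof.
  intros H (F1 & F2 & F3 & F4 & _).
  assert (E1 := Cconj_square_abs _ _ _ F1 (spinor_A H)
    (spinor_alpha H)).
  assert (E2 := Cconj_square_abs _ _ _ F2 (spinor_B H)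
    (spinor_beta H)).
  split; [easy|split; [easy|]].
  assert (E3 := spinor_D H).
  assert (E4 := spinor_zeta H).
  rewrite <- F2, <- F3, <- E2 in E3.
  rewrite <- E1, <- E2 in E4.
  revert E3 E4; generalize (zeta s); clear.
  destruct (f s) as [x y]; cbn [fst snd]; intros z E3 E4.
  destruct (classic (y = 0%C)) as [->|Ny].
  - assert (E : z = 0%C).
    { assert (E5 := f_equal fst E4); destruct z; simpl in E5.
      apply injective_projections; simpl; nra. }
    rewrite E; apply injective_projections; simpl; ring.
  - apply (Cmult_reg_l (y * y)%C); [now apply Cmult_neq_0|].
    transitivity (x * y * (y * Cconj y))%C; [ring|]; rewrite E3; ring.
Qed.

(** Differentiating f1^2, f2^2 and f1 f2 gives three linear equations for f'. The claimed velocity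
    solves them, and they determine f' because f is nonzero, even where one component vanishes. *)
Lemma spinor_is_derive s f :
  data s -> is_spinor A B D f s -> locally s (fun t => is_spinor A B D f t) ->
  is_derive f s (spinor_velocity kappa u v f s).
Proof.
  intros H Hf Hl.
  destruct (spinor_products s f H Hf) as (P1 & P2 & P3).
  destruct (Hf) as (F1 & F2 & F3 & F4 & [l Hd]).
  apply (is_derive_eq _ _ l); [easy|].
  apply is_derive_pair in Hd; destruct Hd as [d1 d2].
  assert (Q1 := is_derive_C_unique _ _ _ _
    (is_derive_ext_loc _ _ _ _ (filter_imp _ _ (fun t Ht => proj1 Ht) Hl)
      (is_derive_Cmult _ _ _ _ _ d1 d1)) (spinor_dA H)).
  assert (Q2 := is_derive_C_unique _ _ _ _
    (is_derive_ext_loc _ _ _ _ (filter_imp _ _ (fun t Ht => proj1 (proj2 Ht)) Hl)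
      (is_derive_Cmult _ _ _ _ _ d2 d2)) (spinor_dB H)).
  assert (Q3 := is_derive_C_unique _ _ _ _
    (is_derive_ext_loc _ _ _ _ (filter_imp _ _ (fun t Ht => proj1 (proj2 (proj2 Ht))) Hl)
      (is_derive_Cmult _ _ _ _ _ d1 d2)) (spinor_dD H)).
  clear d1 d2 H Hl Hf.
  rewrite <- F1, <- P3 in Q1; rewrite <- F2, <- P3 in Q2; rewrite <- F3, <- P1, <- P2 in Q3.
  clear F1 F2 F3 P1 P2 P3.
  unfold spinor_velocity; destruct (f s) as [x y], l as [l1 l2]; cbn [fst snd] in *.
  rewrite Cmult_conj, Cconj_conj in Q2.
  set (m1 := (- (Ci * kappa s / 2) * x - u * Cconj y)%C).
  set (m2 := (- (Ci * kappa s / 2) * y + v * Cconj x)%C).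
  assert (N2 := C2_neq0).
  assert (R1 : (x * (l1 - m1) = 0)%C).
  { apply (Cmult_reg_l 2); [easy|].
    transitivity (l1 * x + x * l1 - 2 * (x * m1))%C; [ring|].
    rewrite Q1; unfold m1; field; easy. }
  assert (R2 : (y * (l2 - m2) = 0)%C).
  { apply (Cmult_reg_l 2); [easy|].
    transitivity (l2 * y + y * l2 - 2 * (y * m2))%C; [ring|].
    rewrite Q2; unfold m2; field; easy. }
  assert (R3 : (x * (l2 - m2) + y * (l1 - m1) = 0)%C).
  { transitivity (l1 * y + x * l2 - (x * m2 + y * m1))%C; [ring|].
    rewrite Q3; unfold m1, m2; field; easy. }
  assert (E : (l1 - m1 = 0)%C /\ (l2 - m2 = 0)%C).
  { destruct (Cmult_integral _ _ R1) as [Ex|E1].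
    - rewrite Ex in R3, F4.
      destruct (Cmult_integral _ _ R2) as [Ey|E2]; [now rewrite Ey in F4|].
      split; [|easy]; rewrite E2 in R3.
      assert (R4 : (y * (l1 - m1) = 0)%C) by (rewrite <- R3; ring).
      destruct (Cmult_integral _ _ R4) as [Ey|]; [now rewrite Ey in F4|easy].
    - split; [easy|]; rewrite E1 in R3.
      destruct (Cmult_integral _ _ R2) as [Ey|]; [|easy].
      assert (R4 : (x * (l2 - m2) = 0)%C) by (rewrite <- R3; ring).
      destruct (Cmult_integral _ _ R4) as [Ex|]; [|easy].
      now rewrite Ex, Ey in F4. }
  assert (Hm : forall p q : C, (p - q = 0)%C -> p = q).
  { intros p q E0; transitivity (p - q + q)%C; [ring|rewrite E0; ring]. }
  destruct E as [E1 E2]; f_equal; now apply Hm.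
Qed.

(** The curvature terms cancel in the determinant, which leaves u |f2|^2 + v |f1|^2. *)
Lemma det_spinor_velocity s f :
  data s -> is_spinor A B D f s ->
  det2 (f s) (spinor_velocity kappa u v f s) = RtoC 1.
Proof.
  intros H Hf; destruct (spinor_products s f H Hf) as (P1 & P2 & _).
  unfold det2, spinor_velocity; cbn [fst snd].
  transitivity (u * (snd (f s) * Cconj (snd (f s))) + v * (fst (f s) * Cconj (fst (f s))))%C;
    [ring|].
  rewrite P1, P2, <- !RtoC_mult, <- RtoC_plus.
  now rewrite (spinor_norm H).
Qed.

(** Conjugation reverses the sign of i kappa / 2, so the terms in conj(f1) and conj(f2) cancel; the
    antilinear part applied twice contributes - u v. *)
Lemma spinor_velocity_is_derive (s : R) (f : R -> C * C) :
  is_derive f s (spinor_velocity kappa u v f s) -> ex_derive kappa s ->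
  is_derive (spinor_velocity kappa u v f) s
    (scale2 (- (Ci * Derive kappa s / 2 + kappa s ^ 2 / 4 + u * v)) (f s))%C.
Proof.
  intros [d1 d2]%is_derive_pair Hk.
  apply Derive_correct, is_derive_RtoC in Hk.
  assert (Hc := fun c => is_derive_Cconst c s).
  assert (Hk2 := is_derive_Cmult _ _ _ _ _ (Hc (- Ci / 2)%C) Hk).
  assert (N2 := C2_neq0).
  assert (E1 : forall k z w c : C,
    (- Ci / 2 * k * z + - c * w = - (Ci * k / 2) * z - c * w)%C)
    by (intros; now field).
  assert (E2 : forall k z w c : C,
    (- Ci / 2 * k * z + c * w = - (Ci * k / 2) * z + c * w)%C)
    by (intros; now field).
  apply is_derive_pair; unfold spinor_velocity, scale2 in *; cbn [fst snd] in *; split.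
  - eapply is_derive_eq.
    + eapply (is_derive_ext (fun t => (- Ci / 2 * kappa t) * fst (f t) + (- u) * Cconj (snd (f t)))%C).
      { intros t; apply E1. }
      exact (is_derive_Cplus _ _ _ _ _ (is_derive_Cmult _ _ _ _ _ Hk2 d1)
        (is_derive_Cmult _ _ _ _ _ (Hc (- u)%C) (is_derive_Cconj _ _ _ d2))).
    + cbv beta; generalize (Derive kappa s) (kappa s); intros k1 k.
      destruct (f s) as [[x x'] [y y']]; apply injective_projections; simpl; field.
  - eapply is_derive_eq.
    + eapply (is_derive_ext (fun t => (- Ci / 2 * kappa t) * snd (f t) + v * Cconj (fst (f t)))%C).
      { intros t; apply E2. }
      exact (is_derive_Cplus _ _ _ _ _ (is_derive_Cmult _ _ _ _ _ Hk2 d2)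
        (is_derive_Cmult _ _ _ _ _ (Hc v) (is_derive_Cconj _ _ _ d1))).
    + cbv beta; generalize (Derive kappa s) (kappa s); intros k1 k.
      destruct (f s) as [[x x'] [y y']]; apply injective_projections; simpl; field.
Qed.
End SpinorData.

(** * Spinor data of a curve in a space form *)

(* Position, velocity and [N = J T], for the form [diag (1, 1, e)] with
   [e = sign G] and [r = sqrt |G|]. *)
Section Frame.
Context {e r G p1 p2 p3 T1 T2 T3 : R}.
Context (He : e * e = 1) (HG : G = e * (r * r)).
Let N1 := r * p2 * T3 - r * p3 * T2.
Let N2 := r * p3 * T1 - r * p1 * T3.
Let N3 := e * (r * p1 * T2 - r * p2 * T1).
Context (Hpp : G * (p1 * p1 + p2 * p2 + e * (p3 * p3)) = 1)
  (HpT : p1 * T1 + p2 * T2 + e * (p3 * T3) = 0)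
  (HTT : T1 * T1 + T2 * T2 + e * (T3 * T3) = 1).

(** Completeness of the frame, dual to its orthonormality: G p p^T + T T^T + N N^T is the inverse
    diag (1, 1, e) of the form. *)
Lemma frame_complete :
  G * (p1 * p1) + T1 * T1 + N1 * N1 = 1 /\
  G * (p2 * p2) + T2 * T2 + N2 * N2 = 1 /\
  G * (p3 * p3) + T3 * T3 + N3 * N3 = e /\
  G * (p1 * p2) + T1 * T2 + N1 * N2 = 0 /\
  G * (p1 * p3) + T1 * T3 + N1 * N3 = 0 /\
  G * (p2 * p3) + T2 * T3 + N2 * N3 = 0.
Proof.
  unfold N1, N2, N3; repeat split;
  nsatz.
Qed.

(** The first three identities are J N = - T; the last compares T x N with the normal [r p] in the
    third coordinate. *)
Lemma frame_cross :
  r * p2 * N3 - r * p3 * N2 = - T1 /\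
  r * p3 * N1 - r * p1 * N3 = - T2 /\
  e * (r * p1 * N2 - r * p2 * N1) = - T3 /\
  T1 * N2 - T2 * N1 = r * p3.
Proof.
  unfold N1, N2, N3; repeat split;
  nsatz.
Qed.
End Frame.

(** For z = f1 / f2, the condition det (f, f') = 1 reads f2^2 = - 1 / z'. With z the stereographic
    coordinate, [B] is - 1 / z', while [D] and [A] are z and z^2 times it; written in the frame they
    have no denominator and extend over the point at infinity. The constants 1/2 and G/2 make
    [spinor_norm] hold. *)
Lemma curved_spinor_data (G e r : R) (P1 P2 P3 T1 T2 T3 W1 W2 W3 kappa : R -> R)
    (s : R) :
  let N1 t := r * P2 t * T3 t - r * P3 t * T2 t in
  let N2 t := r * P3 t * T1 t - r * P1 t * T3 t in
  let N3 t := e * (r * P1 t * T2 t - r * P2 t * T1 t) in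
  G <> 0 -> e * e = 1 -> G = e * (r * r) ->
  is_derive P1 s (T1 s) -> is_derive P2 s (T2 s) -> is_derive P3 s (T3 s) ->
  is_derive T1 s (W1 s) -> is_derive T2 s (W2 s) -> is_derive T3 s (W3 s) ->
  G * (P1 s * P1 s + P2 s * P2 s + e * (P3 s * P3 s)) = 1 ->
  P1 s * T1 s + P2 s * T2 s + e * (P3 s * T3 s) = 0 ->
  T1 s * T1 s + T2 s * T2 s + e * (T3 s * T3 s) = 1 ->
  P1 s * W1 s + P2 s * W2 s + e * (P3 s * W3 s) = - 1 ->
  T1 s * W1 s + T2 s * W2 s + e * (T3 s * W3 s) = 0 ->
  W1 s * N1 s + W2 s * N2 s + e * (W3 s * N3 s) = kappa s ->
  0 <= (1 - r * P3 s) / G -> 0 <= 1 + r * P3 s ->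
  ex_derive kappa s ->
  spinor_data
    (fun t => ((T1 t - N2 t) / G, (T2 t + N1 t) / G))
    (fun t => (- (T1 t + N2 t), T2 t - N1 t))
    (fun t => (r / G * T3 t, r / G * N3 t))
    (fun t => (P1 t, P2 t))
    (fun t => (1 - r * P3 t) / G) (fun t => 1 + r * P3 t) kappa
    (1 / 2) (G / 2) s.
Proof.
  intros N1 N2 N3 G0 He HG dP1 dP2 dP3 dT1 dT2 dT3 Hpp HpT HTT HpW HTW HNW Ha Hb Hk.
  (* Presents the inverse of [G] to [nsatz] as a polynomial relation. *)
  assert (HiG : G * / G = 1) by (now field).
  (* The Frenet equation N' = - kappa T, one coordinate at a time. *)
  assert (dN1 : is_derive N1 s (- kappa s * T1 s)).
  { unfold N1; auto_derive; [repeat split; eexists; eassumption|].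
    erewrite !is_derive_unique by eassumption.
    rewrite <- HNW; unfold N1, N2, N3.
    clear - He HG Hpp HpT HTT HpW HTW; nsatz. }
  assert (dN2 : is_derive N2 s (- kappa s * T2 s)).
  { unfold N2; auto_derive; [repeat split; eexists; eassumption|].
    erewrite !is_derive_unique by eassumption.
    rewrite <- HNW; unfold N1, N2, N3.
    clear - He HG Hpp HpT HTT HpW HTW; nsatz. }
  assert (dN3 : is_derive N3 s (- kappa s * T3 s)).
  { unfold N3; auto_derive; [repeat split; eexists; eassumption|].
    erewrite !is_derive_unique by eassumption.
    rewrite <- HNW; unfold N1, N2, N3.
    clear - He HG Hpp HpT HTT HpW HTW; nsatz. }
  (* The Frenet equation T' = kappa N - G p. *)
  assert (E1 : W1 s = kappa s * N1 s - G * P1 s).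
  { rewrite <- HNW; unfold N1, N2, N3.
    clear - He HG Hpp HpT HTT HpW HTW; nsatz. }
  assert (E2 : W2 s = kappa s * N2 s - G * P2 s).
  { rewrite <- HNW; unfold N1, N2, N3.
    clear - He HG Hpp HpT HTT HpW HTW; nsatz. }
  assert (E3 : W3 s = kappa s * N3 s - G * P3 s).
  { rewrite <- HNW; unfold N1, N2, N3.
    clear - He HG Hpp HpT HTT HpW HTW; nsatz. }
  assert (HN1 : N1 s = r * P2 s * T3 s - r * P3 s * T2 s) by easy.
  assert (HN2 : N2 s = r * P3 s * T1 s - r * P1 s * T3 s) by easy.
  assert (HN3 : N3 s = e * (r * P1 s * T2 s - r * P2 s * T1 s)) by easy.
  clearbody N1 N2 N3.
  destruct (frame_complete He HG Hpp HpT HTT) as (C11 & C22 & C33 & C12 & C13 & C23).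
  destruct (frame_cross He HG Hpp HpT HTT) as (X1 & X2 & X3 & X4).
  rewrite <- ?HN1, <- ?HN2, <- ?HN3 in *.
  assert (HNN : N1 s * N1 s + N2 s * N2 s + e * (N3 s * N3 s) = 1) by
    (clear - He HG Hpp HpT HTT C11 C22 C33; nsatz).
  assert (HTN : N1 s * T1 s + N2 s * T2 s + e * (N3 s * T3 s) = 0) by
    (clear - He HG Hpp HpT HTT HN1 HN2 HN3; nsatz).
  constructor; try assumption.
  - unfold Rdiv; clear - He HG HNN HTT HTN HiG.
    apply injective_projections; simpl; nsatz.
  - unfold Rdiv; clear - He HG HNN HTT HTN HiG C11 C22 C33 X4 Hpp.
    apply injective_projections; simpl; nsatz.
  - unfold Rdiv; clear - He HG HNN HTT HTN HiG C11 C22 C33 X4 Hpp.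
    apply injective_projections; simpl; nsatz.
  - unfold Rdiv; clear - He HG HNN HTT HTN HiG HN1 HN2 HN3 X1 X2 X3 X4 HpT.
    apply injective_projections; simpl; nsatz.
  - unfold Rdiv; clear - He HG HiG Hpp.
    apply injective_projections; simpl; nsatz.
  - field; easy.
  - apply is_derive_pair; cbn [fst snd]; split;
      (auto_derive; [repeat split; eexists; eassumption|]);
      erewrite !is_derive_unique by eassumption;
      simpl; rewrite ?E1, ?E2, ?E3; field; easy.
  - apply is_derive_pair; cbn [fst snd]; split;
      (auto_derive; [repeat split; eexists; eassumption|]);
      erewrite !is_derive_unique by eassumption;
      simpl; rewrite ?E1, ?E2, ?E3; field; easy.
  - apply is_derive_pair; cbn [fst snd]; split;
      (auto_derive; [repeat split; eexists; eassumption|]);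
      erewrite !is_derive_unique by eassumption;
      simpl; rewrite ?E1, ?E2, ?E3; field; easy.
Qed.

(** Here z = P1 + i P2 has |z'| = 1, so - 1 / z' is - conj(z'). Leaving [beta] a function with value
    1 at [s] allows the expression 1 + sqrt |G| x3 to stand for it, as in the curved case. *)
Lemma flat_spinor_data (P1 P2 T1 T2 W1 W2 beta kappa : R -> R) (s : R) :
  is_derive P1 s (T1 s) -> is_derive P2 s (T2 s) ->
  is_derive T1 s (W1 s) -> is_derive T2 s (W2 s) ->
  T1 s * T1 s + T2 s * T2 s = 1 ->
  T1 s * W1 s + T2 s * W2 s = 0 ->
  T1 s * W2 s - T2 s * W1 s = kappa s ->
  beta s = 1 -> ex_derive kappa s ->
  spinor_data
    (fun t => ((P1 t, P2 t) * (P1 t, P2 t) * ((- T1 t)%R, T2 t))%C)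
    (fun t => (- T1 t, T2 t))
    (fun t => ((P1 t, P2 t) * ((- T1 t)%R, T2 t))%C)
    (fun t => (P1 t, P2 t))
    (fun t => P1 t * P1 t + P2 t * P2 t) beta kappa 1 0 s.
Proof.
  intros dP1 dP2 dT1 dT2 HTT HTW HK Hb Hk.
  assert (E1 : W1 s = - kappa s * T2 s) by (rewrite <- HK; clear - HTT HTW; nsatz).
  assert (E2 : W2 s = kappa s * T1 s) by (rewrite <- HK; clear - HTT HTW; nsatz).
  assert (dz : is_derive (fun t => (P1 t, P2 t) : C) s (T1 s, T2 s))
    by (now apply is_derive_pair).
  assert (dB : is_derive (fun t => (- T1 t, T2 t) : C) s (- W1 s, W2 s)).
  { apply is_derive_pair; split; [|easy]; now apply (is_derive_opp T1). }
  constructor; rewrite ?Hb; try assumption.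
  - ring.
  - clear - HTT; apply injective_projections; simpl; nsatz.
  - clear - HTT; apply injective_projections; simpl; nsatz.
  - nra.
  - lra.
  - ring.
  - apply injective_projections; simpl; ring.
  - ring.
  - eapply is_derive_eq.
    + exact (is_derive_Cmult _ _ _ _ _ (is_derive_Cmult _ _ _ _ _ dz dz) dB).
    + rewrite E1, E2; clear - HTT; apply injective_projections; simpl; nsatz.
  - eapply is_derive_eq; [exact dB|].
    rewrite E1, E2; apply injective_projections; simpl; ring.
  - eapply is_derive_eq.
    + exact (is_derive_Cmult _ _ _ _ _ dz dB).
    + rewrite E1, E2; clear - HTT; apply injective_projections; simpl; nsatz.
Qed.

Lemma differentiable_at_3 (f : R -> R) (s : R) :
  differentiable_at 3 f s ->
  is_derive f s (Derive f s) /\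
  is_derive (Derive f) s (Derive (Derive f) s) /\
  ex_derive (Derive (Derive f)) s.
Proof.
  intros H; split; [|split]; [apply Derive_correct, (H 1%nat)
    |apply Derive_correct, (H 2%nat)|apply (H 3%nat)]; auto.
Qed.

Lemma is_derive_constant_on (I : R -> Prop) (f : R -> R) (c s l : R) :
  (forall t, I t -> f t = c) -> locally s I -> is_derive f s l -> l = 0.
Proof.
  intros Hc HI Hf.
  rewrite <- (is_derive_unique _ _ _ Hf).
  rewrite (Derive_ext_loc f (fun _ => c)); [apply Derive_const|].
  revert HI; now apply filter_imp.
Qed.

Lemma is_derive_dot3 (e : R) (a1 a2 a3 b1 b2 b3 : R -> R)
    (s k1 k2 k3 l1 l2 l3 : R) :
  is_derive a1 s k1 -> is_derive a2 s k2 -> is_derive a3 s k3 ->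
  is_derive b1 s l1 -> is_derive b2 s l2 -> is_derive b3 s l3 ->
  is_derive (fun t => a1 t * b1 t + a2 t * b2 t + e * (a3 t * b3 t)) s
    (k1 * b1 s + k2 * b2 s + e * (k3 * b3 s) +
     (a1 s * l1 + a2 s * l2 + e * (a3 s * l3))).
Proof.
  intros; auto_derive; [repeat split; eexists; eassumption|].
  erewrite !is_derive_unique by eassumption; ring.
Qed.

Lemma sign_sqrt_abs (G : R) :
  G <> 0 -> sign G * sign G = 1 /\
  G = sign G * (sqrt (Rabs G) * sqrt (Rabs G)).
Proof.
  intros HG; rewrite sqrt_sqrt by apply Rabs_pos.
  destruct (Rlt_or_le 0 G) as [H|H].
  - rewrite sign_eq_1, Rabs_right by lra; lra.
  - rewrite sign_eq_m1, Rabs_left by lra; lra.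
Qed.

Lemma arclength_spinor_data (G : R) (a b : Rbar) (g : R -> R3) :
  arclength_curve G (Rbar_interval a b) g ->
  exists (A B D : R -> C) (alpha : R -> R) (u v : R),
    u * v = G / 4 /\
    forall s, Rbar_interval a b s ->
      spinor_data A B D (fun t => (x1 (g t), x2 (g t))) alpha
        (fun t => 1 + sqrt (Rabs G) * x3 (g t)) (geodesic_curvature G g) u v s.
Proof.
  intros hg.
  set (P1 := fun t => x1 (g t)); set (P2 := fun t => x2 (g t));
    set (P3 := fun t => x3 (g t)).
  set (T1 := Derive P1); set (T2 := Derive P2); set (T3 := Derive P3).
  set (W1 := Derive T1); set (W2 := Derive T2); set (W3 := Derive T3).
  assert (Hd : forall s, Rbar_interval a b s ->
    (is_derive P1 s (T1 s) /\ is_derive T1 s (W1 s) /\ ex_derive W1 s) /\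
    (is_derive P2 s (T2 s) /\ is_derive T2 s (W2 s) /\ ex_derive W2 s) /\
    (is_derive P3 s (T3 s) /\ is_derive T3 s (W3 s) /\ ex_derive W3 s)).
  { intros s Is; destruct (hg s Is) as (_ & H1 & H2 & H3 & _).
    split; [|split]; now apply differentiable_at_3. }
  assert (HTT : forall s, Rbar_interval a b s ->
    T1 s * T1 s + T2 s * T2 s + sign G * (T3 s * T3 s) = 1)
    by (intros s Is; apply (hg s Is)).
  (* The orthogonality relations come from differentiating the constraints: here <T, T> = 1, later
     <p, p> = 1/G and then <p, T> = 0. *)
  assert (HTW : forall s, Rbar_interval a b s ->
    T1 s * W1 s + T2 s * W2 s + sign G * (T3 s * W3 s) = 0).
  { intros s Is; destruct (Hd s Is) as ((_ & d1 & _) & (_ & d2 & _) & (_ & d3 & _)).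
    assert (H := is_derive_constant_on _ _ _ _ _ HTT (locally_Rbar_interval a b s Is)
      (is_derive_dot3 (sign G) _ _ _ _ _ _ _ _ _ _ _ _ _ d1 d2 d3 d1 d2 d3)).
    lra. }
  destruct (Req_dec G 0) as [HG|HG].
  - assert (HP3 : forall s, Rbar_interval a b s -> P3 s = 0)
      by (intros s Is; now apply (hg s Is)).
    assert (HK : forall s, T1 s * W2 s - T2 s * W1 s = geodesic_curvature G g s).
    { intros s; unfold geodesic_curvature, covariant_acceleration, J, normal.
      destruct (Req_dec_T G 0); [|easy].
      unfold dot, x1, x2, x3; simpl fst; simpl snd.
      rewrite HG, sign_0.
      change (T1 s * W2 s - T2 s * W1 s =
        (W1 s - 0 * (W1 s * P1 s + W2 s * P2 s + 0 * (W3 s * P3 s)) * P1 s) * (0 * T3 s - 1 * T2 s) +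
        (W2 s - 0 * (W1 s * P1 s + W2 s * P2 s + 0 * (W3 s * P3 s)) * P2 s) * (1 * T1 s - 0 * T3 s) +
        0 * ((W3 s - 0 * (W1 s * P1 s + W2 s * P2 s + 0 * (W3 s * P3 s)) * P3 s) * (0 * (0 * T2 s - 0 * T1 s)))).
      ring. }
    eexists _, _, _, _, 1, 0; split; [lra|]; intros s Is.
    destruct (Hd s Is) as ((dP1 & dT1 & dW1) & (dP2 & dT2 & dW2) & _).
    specialize (HTT s Is); specialize (HTW s Is).
    rewrite HG, sign_0 in HTT, HTW.
    apply (flat_spinor_data P1 P2 T1 T2 W1 W2); auto; try lra.
    + change (1 + sqrt (Rabs G) * P3 s = 1); rewrite HP3 by easy; ring.
    + eapply ex_derive_ext; [exact HK|].
      auto_derive; repeat split; auto; eexists; eassumption.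
  - set (e := sign G) in *; set (r := sqrt (Rabs G)).
    destruct (sign_sqrt_abs G HG) as [He HGr]; fold e r in He, HGr.
    assert (HPP : forall s, Rbar_interval a b s ->
      P1 s * P1 s + P2 s * P2 s + e * (P3 s * P3 s) = / G).
    { intros s Is; destruct (hg s Is) as ((H1 & H2 & _) & _).
      destruct (Rlt_or_le 0 G) as [H|H]; [now apply H1|].
      apply H2; lra. }
    assert (HPT : forall s, Rbar_interval a b s ->
      P1 s * T1 s + P2 s * T2 s + e * (P3 s * T3 s) = 0).
    { intros s Is; destruct (Hd s Is) as ((d1 & _) & (d2 & _) & (d3 & _)).
      assert (H := is_derive_constant_on _ _ _ _ _ HPP (locally_Rbar_interval a b s Is)
        (is_derive_dot3 e _ _ _ _ _ _ _ _ _ _ _ _ _ d1 d2 d3 d1 d2 d3)).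
      lra. }
    assert (HPW : forall s, Rbar_interval a b s ->
      P1 s * W1 s + P2 s * W2 s + e * (P3 s * W3 s) = - 1).
    { intros s Is.
      destruct (Hd s Is) as ((d1 & f1 & _) & (d2 & f2 & _) & (d3 & f3 & _)).
      assert (H := is_derive_constant_on _ _ _ _ _ HPT (locally_Rbar_interval a b s Is)
        (is_derive_dot3 e _ _ _ _ _ _ _ _ _ _ _ _ _ d1 d2 d3 f1 f2 f3)).
      specialize (HTT s Is); lra. }
    set (N1 := fun t => r * P2 t * T3 t - r * P3 t * T2 t).
    set (N2 := fun t => r * P3 t * T1 t - r * P1 t * T3 t).
    set (N3 := fun t => e * (r * P1 t * T2 t - r * P2 t * T1 t)).
    assert (HK : forall s,
      W1 s * N1 s + W2 s * N2 s + e * (W3 s * N3 s) = geodesic_curvature G g s).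
    { intros s; unfold geodesic_curvature, covariant_acceleration, J, normal.
      destruct (Req_dec_T G 0); [easy|].
      unfold dot, x1, x2, x3; simpl fst; simpl snd; fold e r.
      set (k := W1 s * P1 s + W2 s * P2 s + e * (W3 s * P3 s)).
      change (W1 s * N1 s + W2 s * N2 s + e * (W3 s * N3 s) =
        (W1 s - G * k * P1 s) * N1 s + (W2 s - G * k * P2 s) * N2 s +
        e * ((W3 s - G * k * P3 s) * N3 s)).
      (* The normal part of the acceleration, a multiple of p, is orthogonal to N. *)
      unfold N1, N2, N3; generalize k; clear - He; intros k; nsatz. }
    eexists _, _, _, _, (1 / 2), (G / 2); split; [lra|]; intros s Is.
    destruct (Hd s Is) as ((dP1 & dT1 & dW1) & (dP2 & dT2 & dW2) & (dP3 & dT3 & dW3)).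
    assert (HP := HPP s Is).
    assert (Hw : G * (P1 s * P1 s + P2 s * P2 s) + (r * P3 s) * (r * P3 s) = 1).
    { assert (HiG : G * / G = 1) by (now field).
      clear - He HGr HP HiG; nsatz. }
    (* On the sphere |r P3| <= 1; on the upper sheet of the hyperboloid r P3 >= 1, and the negative
       [G] restores the sign of the quotient. *)
    assert (Hsign : 0 <= (1 - r * P3 s) / G /\ 0 <= 1 + r * P3 s).
    { assert (Hz : 0 <= P1 s * P1 s + P2 s * P2 s) by nra.
      destruct (Rlt_or_le 0 G) as [H|H].
      - assert (H1 : (r * P3 s) * (r * P3 s) <= 1) by nra.
        split; [apply Rdiv_le_0_compat; nra|nra].
      - assert (HG0 : G < 0) by lra.
        destruct (hg s Is) as ((_ & H2 & _) & _).
        destruct (H2 HG0) as [_ H3]; change (0 < P3 s) in H3.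
        assert (Hr : 0 <= r * P3 s)
          by (apply Rmult_le_pos; [apply sqrt_pos|lra]).
        assert (H1 : 1 <= (r * P3 s) * (r * P3 s)) by nra.
        split; [|lra].
        replace ((1 - r * P3 s) / G) with ((r * P3 s - 1) / - G) by (now field).
        apply Rdiv_le_0_compat; nra. }
    apply (curved_spinor_data G e r P1 P2 P3 T1 T2 T3 W1 W2 W3); auto.
    + rewrite HP; now field.
    + apply Hsign.
    + apply Hsign.
    + eapply ex_derive_ext; [exact HK|].
      unfold N1, N2, N3; auto_derive; repeat split; auto; eexists; eassumption.
Qed.

(** * The Schwarzian derivative *)

Lemma homogeneous_coordinates_parallel (w w' : C * C) (P : CP1) :
  homogeneous_coordinates w P -> homogeneous_coordinates w' P ->
  (fst w * snd w' = snd w * fst w')%C.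
Proof.
  destruct P as [z|]; intros [_ E] [_ E']; rewrite E, E'; ring.
Qed.

(** Since h = |f2|^2, the point at infinity occurs exactly where f2 = 0; elsewhere f1 / f2 = f1
    conj(f2) / |f2|^2 is the stereographic coordinate. *)
Lemma spinor_homogeneous_coordinates (G : R) (p : R3) (f : C * C) :
  f <> (RtoC 0, RtoC 0) ->
  (snd f * Cconj (snd f) = (1 + sqrt (Rabs G) * x3 p)%R)%C ->
  (fst f * Cconj (snd f) = (x1 p, x2 p))%C ->
  homogeneous_coordinates f (conformal_model G p).
Proof.
  unfold conformal_model; set (h := 1 + sqrt (Rabs G) * x3 p).
  destruct f as [x y]; cbn [fst snd]; intros Hf Hb Hz.
  destruct (Req_dec_T h 0) as [H0|H0]; simpl.
  - assert (Hy : y = 0%C).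
    { assert (H := f_equal fst Hb); destruct y as [y1 y2]; simpl in H.
      apply injective_projections; simpl; nra. }
    split; [|easy]; intros E; apply Hf; now rewrite E, Hy.
  - assert (Hy : y <> 0%C).
    { intros E; rewrite E in Hb.
      apply H0; assert (H := f_equal fst Hb); simpl in H; lra. }
    split; [easy|].
    assert (Hc : Cconj y <> 0%C).
    { intros E; apply Hy; rewrite <- (Cconj_conj y), E.
      apply injective_projections; simpl; ring. }
    apply (Cmult_reg_l (Cconj y)); [easy|].
    transitivity (x * Cconj y)%C; [ring|].
    transitivity ((x1 p / h, x2 p / h)%R * (y * Cconj y))%C; [|ring].
    rewrite Hz, Hb; apply injective_projections; simpl; now field.
Qed.

(* Differentiating the parallelism shows [h = c f] with [c^2 = 1], without
   having to differentiate [c]. *)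
Lemma parallel_spinor (A B D : R -> C) (a b : Rbar) (f h : R -> C * C)
    (f' h' : C * C) (s : R) :
  (forall t, Rbar_interval a b t -> (fst (h t) * snd (f t) = snd (h t) * fst (f t))%C) ->
  Rbar_interval a b s ->
  is_derive f s f' -> is_derive h s h' ->
  is_spinor A B D f s ->
  det2 (f s) f' = 1%C -> det2 (h s) h' = 1%C ->
  is_spinor A B D h s.
Proof.
  intros Hp Is df dh (F1 & F2 & F3 & F4 & F5) Wf Wh.
  assert (Hs := Hp s Is).
  destruct (proj1 (is_derive_pair _ _ _) df) as [df1 df2].
  destruct (proj1 (is_derive_pair _ _ _) dh) as [dh1 dh2].
  assert (Hd : (fst h' * snd (f s) + fst (h s) * snd f' =
    snd h' * fst (f s) + snd (h s) * fst f')%C).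
  { refine (is_derive_C_unique _ _ _ _
      (is_derive_ext_loc _ _ _ _ (filter_imp _ _ Hp (locally_Rbar_interval a b s Is))
        (is_derive_Cmult _ _ _ _ _ dh1 df2))
      (is_derive_Cmult _ _ _ _ _ dh2 df1)). }
  assert (Hh : exists c : C, fst (h s) = (c * fst (f s))%C /\ snd (h s) = (c * snd (f s))%C).
  (* If h = c f, then det (h, f') = c det (f, f') = c. *)
  { exists (fst (h s) * snd f' - snd (h s) * fst f')%C; split.
    - transitivity (fst (h s) * det2 (f s) f')%C; [rewrite Wf; ring|].
      unfold det2.
      transitivity (fst (h s) * snd f' * fst (f s) - fst f' * (fst (h s) * snd (f s)))%C; [ring|].
      rewrite Hs; ring.
    - transitivity (snd (h s) * det2 (f s) f')%C; [rewrite Wf; ring|].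
      unfold det2.
      transitivity (snd f' * (snd (h s) * fst (f s)) - snd (h s) * fst f' * snd (f s))%C; [ring|].
      rewrite <- Hs; ring. }
  destruct Hh as (c & Hc1 & Hc2).
  (* The differentiated parallelism says det (h, f') = det (f, h'); hence c^2 = c det (h, f') = c
     det (f, h') = det (h, h') = 1. *)
  assert (Hcc : (c * c = 1)%C).
  { rewrite Hc1, Hc2 in Hd; unfold det2 in Wf, Wh; rewrite Hc1, Hc2 in Wh.
    transitivity (c * c * (fst (f s) * snd f' - snd (f s) * fst f'))%C;
      [rewrite Wf; ring|].
    rewrite <- Wh.
    transitivity (c * (c * fst (f s) * snd f') - c * (c * snd (f s) * fst f'))%C; [ring|].
    assert (Hd' : (c * fst (f s) * snd f' - c * snd (f s) * fst f' =
      fst (f s) * snd h' - snd (f s) * fst h')%C).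
    { transitivity (fst h' * snd (f s) + c * fst (f s) * snd f'
        - fst h' * snd (f s) - c * snd (f s) * fst f')%C; [ring|].
      rewrite Hd; ring. }
    transitivity (c * (c * fst (f s) * snd f' - c * snd (f s) * fst f'))%C; [ring|].
    rewrite Hd'; ring. }
  refine (conj _ (conj _ (conj _ (conj _ _)))).
  - rewrite Hc1, <- F1; transitivity (c * c * (fst (f s) * fst (f s)))%C; [ring|].
    rewrite Hcc; ring.
  - rewrite Hc2, <- F2; transitivity (c * c * (snd (f s) * snd (f s)))%C; [ring|].
    rewrite Hcc; ring.
  - rewrite Hc1, Hc2, <- F3; transitivity (c * c * (fst (f s) * snd (f s)))%C; [ring|].
    rewrite Hcc; ring.
  - intros E; rewrite E in Wh; unfold det2 in Wh; cbn [fst snd] in Wh.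
    assert (H := f_equal fst Wh); simpl in H; lra.
  - now exists h'.
Qed.

(** * From the stationary mKdV equation to the stationary KdV equation *)

Lemma stationary_KdV_of_mKdV (G mu lambda nu k k1 k2 : R) :
  k2 + / 2 * k ^ 3 + (mu + G) * k + lambda = 0 ->
  k1 ^ 2 = - / 4 * k ^ 4 - (mu + G) * k ^ 2 - 2 * lambda * k - nu ->
  let c := mu - G / 2 in
  let d := - nu / 4 - G ^ 2 / 16 - mu * G / 4 in
  let e := c * d + lambda ^ 2 / 4 + mu ^ 2 * G / 4 - nu * G / 4 in
  let Q : C := (k ^ 2 / 4 + G / 4, k1 / 2) in
  let Q1 : C := (k * k1 / 2, k2 / 2) in
  (Q1 ^ 2 + 2 * Q ^ 3 + c * Q ^ 2 + 2 * d * Q + e = 0)%C.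
Proof.
  intros H2 H1 c d e Q Q1.
  assert (E2 : k2 = - (/ 2 * k ^ 3 + (mu + G) * k + lambda)) by lra.
  set (rhs := - / 4 * k ^ 4 - (mu + G) * k ^ 2 - 2 * lambda * k - nu) in H1.
  assert (H3 : k1 ^ 2 - rhs = 0) by lra.
  unfold Q, Q1, e, d, c; rewrite E2; clear - H3; apply injective_projections.
  (* Once [k2] is eliminated, the real part is affine in k1^2, and the imaginary part is k1 times
     such an expression. The cofactors are the coefficients of k1^2, and the parameters c, d, e make
     the remainders vanish. *)
  - transitivity ((k ^ 2 / 4 - 3 * (k ^ 2 + G) / 8 - (mu - G / 2) / 4) *
      (k1 ^ 2 - rhs)); [unfold rhs; simpl; field|].
    rewrite H3; simpl; ring.
  - transitivity (- k1 / 4 * (k1 ^ 2 - rhs)); [unfold rhs; simpl; field|].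
    rewrite H3; simpl; ring.
Qed.

Lemma is_derive_schwarzian_curvature (G : R) (k k' : R -> R) (s l l' : R) :
  is_derive k s l -> is_derive k' s l' ->
  is_derive (fun t => ((k t ^ 2 / 4 + G / 4)%R, (k' t / 2)%R) : C) s
    ((k s * l / 2)%R, (l' / 2)%R).
Proof.
  intros H H'; apply is_derive_pair; cbn [fst snd]; split.
  - auto_derive; [now exists l|]; erewrite is_derive_unique by eassumption; field.
  - auto_derive; [now exists l'|]; erewrite is_derive_unique by eassumption; field.
Qed.

Theorem lemma1 (G : R) (a b : Rbar) (g : R -> R3)
    (hg : arclength_curve G (Rbar_interval a b) g) :
  let I := Rbar_interval a b in
  let kappa := geodesic_curvature G g in
  let g_CP1 := fun s : R => conformal_model G (g s) in
  (forall q : R -> C,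
     is_schwarzian I g_CP1 q <->
     (forall s : R, I s ->
        q s = (Ci * Derive kappa s / 2 + kappa s ^ 2 / 4 + G / 4)%C)) /\
  (forall (mu lambda nu : R) (q : R -> C),
     stationary_mKdV G mu lambda nu I kappa ->
     is_schwarzian I g_CP1 q ->
     let c := mu - G / 2 in
     let d := - nu / 4 - G ^ 2 / 16 - mu * G / 4 in
     let e := c * d + lambda ^ 2 / 4 + mu ^ 2 * G / 4 - nu * G / 4 in
     stationary_KdV c d e I q).
Proof.
  intros I kappa g_CP1.
  assert (HI : forall s, I s -> locally s I) by (apply locally_Rbar_interval).
  destruct (arclength_spinor_data G a b g hg) as (A & B & D & alpha & u & v & Huv & Hdata).
  destruct (global_spinor A B D a b) as [f Hf].
  { intros s Is; eapply local_spinor.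
    generalize (HI s Is); apply filter_imp, Hdata. }
  assert (Hhom : forall s, I s -> homogeneous_coordinates (f s) (g_CP1 s)).
  { intros s Is; destruct (spinor_products s f (Hdata s Is) (Hf s Is)) as (_ & H1 & H2).
    apply spinor_homogeneous_coordinates; [apply (Hf s Is)|easy|easy]. }
  (* Stated for every spinor [h]: besides [f], it will be applied to an arbitrary rescaled lift. *)
  assert (Hder : forall h, (forall s, I s -> is_spinor A B D h s) ->
    forall s, I s -> is_derive h s (spinor_velocity kappa u v h s)).
  { intros h Hh s Is; apply (spinor_is_derive s h (Hdata s Is) (Hh s Is)).
    generalize (HI s Is); now apply filter_imp. }
  assert (Hder2 : forall h, (forall s, I s -> is_spinor A B D h s) ->
    forall s, I s -> is_derive (spinor_velocity kappa u v h) s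
      (scale2 (- (Ci * Derive kappa s / 2 + kappa s ^ 2 / 4 + G / 4)) (h s))%C).
  { intros h Hh s Is.
    replace (G / 4)%C with (u * v)%C.
    - apply spinor_velocity_is_derive; [now apply Hder|apply (Hdata s Is)].
    - rewrite <- RtoC_mult, Huv; apply injective_projections; simpl; field. }
  assert (Hdet : forall s, I s -> det2 (f s) (spinor_velocity kappa u v f s) = 1%C)
    by (intros s Is; exact (det_spinor_velocity s f (Hdata s Is) (Hf s Is))).
  assert (Hq : forall q, is_schwarzian I g_CP1 q <->
    forall s, I s -> q s = (Ci * Derive kappa s / 2 + kappa s ^ 2 / 4 + G / 4)%C).
  { intros q; split.
    - intros (lift & m & h1 & h2 & H); set (h := fun t : R => scale2 (m t) (lift t)) in H.
      (* Any lift with determinant 1 is parallel to [f], hence a spinor for the same [A], [B] and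
         [D]. *)
      assert (Hh : forall s, I s -> is_spinor A B D h s).
      { intros s Is; destruct (H s Is) as (_ & d1 & _ & W & _).
        apply (parallel_spinor A B D a b f h (spinor_velocity kappa u v f s) (h1 s));
          auto.
        intros t It; assert (E := homogeneous_coordinates_parallel _ _ _
          (proj1 (H t It)) (Hhom t It)).
        unfold h, scale2; cbn [fst snd].
        transitivity (m t * (fst (lift t) * snd (f t)))%C; [ring|]; rewrite E; ring. }
      intros s Is; destruct (H s Is) as (_ & _ & d2 & W & E1 & E2).
      (* Near [s] the given derivative [h1] is the spinor velocity of [h], whose derivative is
         known. So q - Q annihilates the nonzero vector [h s]. *)
      assert (Eh2 : h2 s = scale2 (- (Ci * Derive kappa s / 2 + kappa s ^ 2 / 4 + G / 4))%C (h s)).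
      { apply (is_derive_C2_unique h1 s); [easy|].
        apply (is_derive_ext_loc (spinor_velocity kappa u v h)); [|now apply Hder2].
        generalize (HI s Is); apply filter_imp; intros t It.
        apply (is_derive_C2_unique h t); [now apply Hder|apply (H t It)]. }
      rewrite Eh2 in E1, E2; unfold scale2 at 1 in E1; unfold scale2 at 1 in E2;
        cbn [fst snd] in E1, E2.
      set (Q := (Ci * Derive kappa s / 2 + kappa s ^ 2 / 4 + G / 4)%C) in *.
      destruct (Hh s Is) as (_ & _ & _ & Nh & _).
      assert (R1 : (fst (h s) * (q s - Q) = 0)%C) by (rewrite <- E1; ring).
      assert (R2 : (snd (h s) * (q s - Q) = 0)%C) by (rewrite <- E2; ring).
      destruct (Cmult_integral _ _ R1) as [Z1|Z];
        [destruct (Cmult_integral _ _ R2) as [Z2|Z]|].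
      + destruct Nh; now apply injective_projections.
      + transitivity (q s - Q + Q)%C; [ring|rewrite Z; ring].
      + transitivity (q s - Q + Q)%C; [ring|rewrite Z; ring].
    - intros Eq.
      (* The spinor is already normalized, so it serves as the lift with factor 1. *)
      exists f, (fun _ => RtoC 1), (spinor_velocity kappa u v f),
        (fun s => scale2 (- q s)%C (f s)).
      assert (E1 : forall w, scale2 (RtoC 1) w = w).
      { intros [x y]; unfold scale2; simpl; f_equal; ring. }
      intros ghat s Is; unfold ghat; cbv beta; rewrite E1.
      refine (conj _ (conj _ (conj _ (conj _ (conj _ _))))).
      + now apply Hhom.
      + apply (is_derive_ext f); [intros t; now rewrite E1|now apply Hder].
      + rewrite (Eq s Is); now apply Hder2.
      + now apply Hdet.
      + unfold scale2; cbn [fst snd]; ring.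
      + unfold scale2; cbn [fst snd]; ring. }
  split; [exact Hq|].
  intros mu lambda nu q Hk H c d e s Is; rewrite Hq in H.
  assert (EQ : forall t, I t -> q t =
    ((kappa t ^ 2 / 4 + G / 4)%R, (Derive kappa t / 2)%R)).
  { intros t It; rewrite (H t It); apply injective_projections; simpl; field. }
  destruct (Hk s Is) as (Hk1 & Hk2 & Hk3).
  exists ((kappa s * Derive kappa s / 2)%R, (Derive_n kappa 2 s / 2)%R); split.
  - apply (is_derive_ext_loc (fun t => ((kappa t ^ 2 / 4 + G / 4)%R, (Derive kappa t / 2)%R))).
    { generalize (HI s Is); apply filter_imp; intros t It; now rewrite EQ. }
    assert (d1 : is_derive kappa s (Derive kappa s))
      by (apply Derive_correct, (Hk1 1%nat); auto).
    assert (d2 : is_derive (Derive kappa) s (Derive_n kappa 2 s))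
      by (apply Derive_correct, (Hk1 2%nat); auto).
    now apply is_derive_schwarzian_curvature.
  - rewrite (EQ s Is); now apply stationary_KdV_of_mKdV.
Qed.
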